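(* A De Morgan clone $\mathsf C$ with $\mathsf{DMA}\subseteq\mathsf C$ is truth-equational if and only if it contains $\mathsf t_{\mathsf n\mapsto\mathsf n}$ or $\mathsf t_{\mathsf b\mapsto\mathsf b}$.
   Context: Let $\mathrm{DM}_4=\{\mathsf t,\mathsf f,\mathsf n,\mathsf b\}$, with truth order $\le$ ($\mathsf f$ least, $\mathsf t$ greatest, $\mathsf n,\mathsf b$ incomparable; meet $\wedge$, join $\vee$) and De Morgan negation $-\mathsf t=\mathsf f$, $-\mathsf f=\mathsf t$, $-\mathsf n=\mathsf n$, $-\mathsf b=\mathsf b$. A De Morgan function is a map $\mathrm{DM}_4^n\to\mathrm{DM}_4$, $n\ge1$; a De Morgan clone is a set of such functions closed under composition and containing all projections; constants are unary constant functions. $\mathsf{DMA}$ is the clone generated by $\wedge,\vee,\mathsf t,\mathsf f,-$. $\mathsf t_{\mathsf n\mapsto\mathsf n}$ is the unary function sending $\mathsf n$ to $\mathsf n$ and every other element to $\mathsf t$; $\mathsf t_{\mathsf b\mapsto\mathsf b}$ sends $\mathsf b$ to $\mathsf b$ and every other element to $\mathsf t$. A clone matrix is a pair $\langle\mathsf D,G\rangle$ of a clone $\mathsf D$ on a set $A$ and a subset $G\subseteq A$; its logic is the relation $\Gamma(\overline x)\vdash\Theta(\overline x)$ between subsets of $\mathsf D$ holding iff for every tuple $\overline a$ in $A$, $\Gamma(\overline a)\subseteq G$ implies $\Theta(\overline a)\subseteq G$. A clone homomorphism $h\colon\mathsf D\to\mathsf D'$ maps $n$-ary functions to $n$-ary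 functions, preserves composition, and sends the $i$-th $n$-ary projection to the $i$-th $n$-ary projection. A model of the logic of $\langle\mathsf D,G\rangle$ is a clone matrix $\langle\mathsf D',G'\rangle$ together with a surjective clone homomorphism $h\colon\mathsf D\to\mathsf D'$ such that $\Gamma\vdash\Theta$ in the logic of $\langle\mathsf D,G\rangle$ implies $h[\Gamma]\vdash h[\Theta]$ in the logic of $\langle\mathsf D',G'\rangle$. The Leibniz congruence $\Omega_{\mathsf D'}(G')$ on the base set $A'$ of $\mathsf D'$ consists of the pairs $\langle a,b\rangle$ such that $f(a,\overline c)\in G'\iff f(b,\overline c)\in G'$ for every $f\in\mathsf D'$ and every tuple $\overline c$ in $A'$. The clone $\mathsf C$ (with designated set $\{\mathsf t,\mathsf b\}$) is truth-equational if there is a set of pairs of unary functions $t_i,u_i\in\mathsf C$ ($i\in I$) such that for every model $\langle\mathsf D',G'\rangle$, $h$ of the logic of $\langle\mathsf C,\{\mathsf t,\mathsf b\}\rangle$ and every $a\in A'$: $a\in G'$ iff $\langle h(t_i)(a),h(u_i)(a)\rangle\in\Omega_{\mathsf D'}(G')$ for all $i\in I$. *)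

(* Defs.v *)
(* MathComp, with the [set] library of MathComp-Analysis (mathcomp.classical). *)
From HB Require Import structures.
From mathcomp Require Import all_boot all_order.
From mathcomp Require Import boolp classical_sets.

Set Implicit Arguments.
Unset Strict Implicit.
Unset Printing Implicit Defensive.

Local Open Scope classical_set_scope.

(* Operations have arity at least 1, so [op A n] is the type of operations of
   arity n.+1; in particular [op A 0] is the type of unary operations. *)
Definition op (A : Type) (n : nat) : Type := n.+1.-tuple A -> A.

Definition opset (A : Type) : Type := forall n : nat, set (op A n).

Definition sub_opset (A : Type) (C D : opset A) : Prop :=
  forall n : nat, C n `<=` D n.

Definition proj_op (A : Type) (n : nat) (i : 'I_n.+1) : op A n :=
  fun x => tnth x i.

Definition comp_op (A : Type) (m n : nat) (f : op A m)
    (g : 'I_m.+1 -> op A n) : op A n :=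
  fun x => f [tuple g i x | i < m.+1].

Record is_clone (A : Type) (D : opset A) : Prop := IsClone {
  clone_proj : forall (n : nat) (i : 'I_n.+1), D n (proj_op i);
  clone_comp : forall (m n : nat) (f : op A m) (g : 'I_m.+1 -> op A n),
    D m f -> (forall i, D n (g i)) -> D n (comp_op f g)
}.

Definition generated_clone (A : Type) (F : opset A) : opset A :=
  fun n f => forall D : opset A, is_clone D -> sub_opset F D -> D n f.

(* [Gamma |- Theta] in the logic of a clone matrix with designated set [G].
   Both sides are sets of operations in one common tuple of variables; in
   [is_model] they are restricted to subsets of the clone. *)
Definition entails (A : Type) (G : set A) (n : nat)
    (Gamma Theta : set (op A n)) : Prop :=
  forall a : n.+1.-tuple A,
    [set f a | f in Gamma] `<=` G -> [set f a | f in Theta] `<=` G.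

(* A map between clones is represented by a total map on operations, of which
   only the values on members of [D] are constrained or used. *)
Record clone_hom (A A' : Type) (D : opset A) (D' : opset A')
    (h : forall n : nat, op A n -> op A' n) : Prop := CloneHom {
  hom_in : forall (n : nat) (f : op A n), D n f -> D' n (h n f);
  hom_proj : forall (n : nat) (i : 'I_n.+1),
    h n (proj_op i) = proj_op i;
  hom_comp : forall (m n : nat) (f : op A m) (g : 'I_m.+1 -> op A n),
    D m f -> (forall i, D n (g i)) ->
    h n (comp_op f g) = comp_op (h m f) (fun i => h n (g i))
}.

Record is_model (A A' : Type) (D : opset A) (G : set A)
    (D' : opset A') (G' : set A')
    (h : forall n : nat, op A n -> op A' n) : Prop := IsModel {
  model_clone : is_clone D';
  model_hom : clone_hom D D' h;
  model_surj : forall n : nat, D' n `<=` [set h n f | f in D n];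
  model_entails : forall (n : nat) (Gamma Theta : set (op A n)),
    Gamma `<=` D n -> Theta `<=` D n -> entails G Gamma Theta ->
    entails G' [set h n f | f in Gamma] [set h n f | f in Theta]
}.

Definition leibniz (A : Type) (D : opset A) (G : set A) (a b : A) : Prop :=
  forall (n : nat) (f : op A n) (c : n.-tuple A), D n f ->
    (G (f [tuple of a :: c]) <-> G (f [tuple of b :: c])).

Definition truth_equational (A : Type) (C : opset A) (G : set A) : Prop :=
  exists2 E : set (op A 0 * op A 0),
    E `<=` C 0 `*` C 0 &
    forall (A' : Type) (D' : opset A') (G' : set A')
           (h : forall n : nat, op A n -> op A' n),
      is_model C G D' G' h ->
      forall a : A',
        G' a <-> (forall t u, E (t, u) ->
                  leibniz D' G' (h 0 t [tuple a]) (h 0 u [tuple a])).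

Inductive DM4 : Type := DMt | DMf | DMn | DMb.

Definition DM4_code (x : DM4) : bool * bool :=
  match x with
  | DMt => (true, true) | DMf => (false, false)
  | DMn => (true, false) | DMb => (false, true)
  end.

Definition DM4_decode (p : bool * bool) : DM4 :=
  match p with
  | (true, true) => DMt | (false, false) => DMf
  | (true, false) => DMn | (false, true) => DMb
  end.

Lemma DM4_codeK : cancel DM4_code DM4_decode.
Proof. by case. Qed.

HB.instance Definition _ := Finite.copy DM4 (can_type DM4_codeK).

Definition DM4_le (x y : DM4) : bool :=
  match x, y with
  | DMf, _ | _, DMt | DMn, DMn | DMb, DMb => true
  | _, _ => false
  end.

Definition DM4_meet (x y : DM4) : DM4 :=
  match x, y with
  | DMt, z | z, DMt => z
  | DMn, DMn => DMn
  | DMb, DMb => DMb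
  | _, _ => DMf
  end.

Definition DM4_join (x y : DM4) : DM4 :=
  match x, y with
  | DMf, z | z, DMf => z
  | DMn, DMn => DMn
  | DMb, DMb => DMb
  | _, _ => DMt
  end.

Lemma DM4_le_refl : reflexive DM4_le.
Proof. by case. Qed.

Lemma DM4_le_anti : antisymmetric DM4_le.
Proof. by case; case. Qed.

Lemma DM4_le_trans : transitive DM4_le.
Proof. by case; case; case. Qed.

Lemma DM4_meetP x y z : DM4_le x (DM4_meet y z) = DM4_le x y && DM4_le x z.
Proof. by case: x; case: y; case: z. Qed.

Lemma DM4_joinP x y z : DM4_le (DM4_join x y) z = DM4_le x z && DM4_le y z.
Proof. by case: x; case: y; case: z. Qed.

Lemma DM4_le0x x : DM4_le DMf x.
Proof. by case: x. Qed.

Lemma DM4_lex1 x : DM4_le x DMt.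
Proof. by case: x. Qed.

Fact DM4_display : Order.disp_t. Proof. exact: Order.Disp tt tt. Qed.

HB.instance Definition _ :=
  Order.Le_isPOrder.Build DM4_display DM4 DM4_le_refl DM4_le_anti DM4_le_trans.
HB.instance Definition _ :=
  Order.POrder_MeetJoin_isLattice.Build DM4_display DM4 DM4_meetP DM4_joinP.
HB.instance Definition _ := Order.hasBottom.Build DM4_display DM4 DM4_le0x.
HB.instance Definition _ := Order.hasTop.Build DM4_display DM4 DM4_lex1.

Definition DM4_neg (x : DM4) : DM4 :=
  match x with DMt => DMf | DMf => DMt | DMn => DMn | DMb => DMb end.

Definition meet_op : op DM4 1 :=
  fun x => Order.meet (tnth x ord0) (tnth x ord_max).
Definition join_op : op DM4 1 :=
  fun x => Order.join (tnth x ord0) (tnth x ord_max).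
Definition neg_op : op DM4 0 := fun x => DM4_neg (tnth x ord0).
Definition const_op (c : DM4) : op DM4 0 := fun _ => c.

Inductive DMA_gen : opset DM4 :=
  | DMA_meet : DMA_gen meet_op
  | DMA_join : DMA_gen join_op
  | DMA_t : DMA_gen (const_op DMt)
  | DMA_f : DMA_gen (const_op DMf)
  | DMA_neg : DMA_gen neg_op.

Definition DMA : opset DM4 := generated_clone DMA_gen.

Definition t_n_to_n : op DM4 0 :=
  fun x => if tnth x ord0 is DMn then DMn else DMt.
Definition t_b_to_b : op DM4 0 :=
  fun x => if tnth x ord0 is DMb then DMb else DMt.

Definition designated : set DM4 := [set DMt; DMb].

(* Main.v *)
Require Import Defs.
From mathcomp Require Import all_boot all_order.
From mathcomp Require Import boolp classical_sets.

(** Right to left, truth is defined by [t_b(x) = x] when [t_b] is available, and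
    by [t_n(x) = t], [x \/ -x = x] when [t_n] is. An equation valid on the
    designated elements passes to the Leibniz congruence of every model, since
    substituting its sides for a variable in any operation yields a rule of the
    logic; conversely the equations yield membership through [|- t_b(x)],
    respectively [|- t] and [t_n(x) |- x \/ -x].

    Left to right, the defining equations already have to separate [b] from [n]
    in DM4 itself, where the Leibniz congruence is the identity. So some unary
    operation of the clone does not commute with the automorphism swapping [n]
    and [b], and De Morgan operations turn it into [t_n] or [t_b]. *)

Set Implicit Arguments.
Unset Strict Implicit.
Unset Printing Implicit Defensive.

Local Open Scope classical_set_scope.

(** * Substitution into the first argument *)

Definition subst_head_args (A : Type) (n : nat) (p : op A 0) :
    'I_n.+1 -> op A n :=
  fun i => if i == ord0 then comp_op p (fun=> proj_op ord0) else proj_op i.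

(** Inner operations of [comp_op] share one arity, so the unary [p] is first lifted along the
    projection [proj_op ord0]; the other variables stay in place. *)
Definition subst_head (A : Type) (n : nat) (f : op A n) (p : op A 0) : op A n :=
  comp_op f (subst_head_args p).

Lemma tuple1E (A : Type) (x : 1.-tuple A) : [tuple tnth x ord0] = x.
Proof. by apply: eq_from_tnth => i; rewrite ord1. Qed.

Lemma subst_headE (A : Type) (n : nat) (f : op A n) (p : op A 0)
    (x : n.+1.-tuple A) :
  subst_head f p x =
  f [tuple of p [tuple tnth x ord0] :: behead_tuple x].
Proof.
rewrite /subst_head /comp_op; congr (f _); apply: eq_from_tnth => i.
rewrite tnth_mktuple /subst_head_args; case: (unliftP ord0 i) => [j|] ->.
  by rewrite /= [RHS]tnthS tnth_behead /proj_op; congr tnth; apply: val_inj;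
     rewrite /= inordK // ltnS.
rewrite eqxx /comp_op [RHS]tnth0; congr (p _); apply: eq_from_tnth => j.
by rewrite tnth_mktuple ord1.
Qed.

Section CloneTheory.
Variables (A : Type) (C : opset A).
Hypothesis hC : is_clone C.

Lemma clone_subst_head_args (n : nat) (p : op A 0) i :
  C p -> C (@subst_head_args A n p i).
Proof.
move=> Cp; rewrite /subst_head_args; case: ifP => _.
  by apply: (clone_comp hC) => // _; exact: clone_proj.
exact: clone_proj.
Qed.

Lemma clone_subst_head (n : nat) (f : op A n) (p : op A 0) :
  C f -> C p -> C (subst_head f p).
Proof.
move=> Cf Cp; apply: (clone_comp hC) => // i; exact: clone_subst_head_args.
Qed.

Section Hom.
Variables (A' : Type) (D' : opset A') (h : forall n : nat, op A n -> op A' n).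
Hypothesis hh : clone_hom C D' h.

Lemma hom_subst_head (n : nat) (f : op A n) (p : op A 0) :
  C f -> C p -> h (subst_head f p) = subst_head (h f) (h p).
Proof.
move=> Cf Cp; rewrite /subst_head (hom_comp hh) //; last first.
  by move=> i; exact: clone_subst_head_args.
congr comp_op; apply: funext => i; rewrite /subst_head_args; case: ifP => _.
  rewrite (hom_comp hh) //; last by move=> _; exact: clone_proj.
  by congr comp_op; apply: funext => _; exact: (hom_proj hh).
exact: (hom_proj hh).
Qed.

End Hom.

(** * Rules and Leibniz congruences in models *)

Section Model.
Variables (G : set A) (A' : Type) (D' : opset A') (G' : set A').
Variable h : forall n : nat, op A n -> op A' n.
Hypothesis hM : is_model C G D' G' h.

Lemma model_rule (n : nat) (Gamma : set (op A n)) (q : op A n)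
    (a : n.+1.-tuple A') :
  Gamma `<=` C (n:=n) -> C q ->
  (forall x, (forall p, Gamma p -> G (p x)) -> G (q x)) ->
  (forall p, Gamma p -> G' (h p a)) -> G' (h q a).
Proof.
move=> CGamma Cq rule prem.
have := @model_entails _ _ _ _ _ _ _ hM n Gamma [set q] CGamma.
apply.
- by move=> _ ->.
- move=> x Gx _ [_ -> <-]; apply: rule => p Gp; apply: Gx; exists p => //.
- by move=> _ [_ [p Gp <-] <-]; exact: prem.
- by exists (h q) => //; exists q.
Qed.

(** Since [p] and [q] agree on designated arguments, [x, f(p(x), z) |- f(q(x), z)] is a rule for
    each [f] in [C], hence holds in the model. By surjectivity of [h] these [f] yield every test of
    the Leibniz congruence. *)
Lemma model_leibniz (p q : op A 0) (a : A') :
  C p -> C q -> (forall x, G (tnth x ord0) -> p x = q x) -> G' a ->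
  leibniz D' G' (h p [tuple a]) (h q [tuple a]).
Proof.
have imp r s : C r -> C s -> (forall x, G (tnth x ord0) -> r x = s x) ->
    G' a -> forall n (f : op A n) (c : n.-tuple A'), C f ->
    G' (h f [tuple of h r [tuple a] :: c]) ->
    G' (h f [tuple of h s [tuple a] :: c]).
  move=> Cr Cs rs Ga n f c Cf Gf.
  have hE t : C t -> h (subst_head f t) [tuple of a :: c] =
                     h f [tuple of h t [tuple a] :: c].
    move=> Ct; rewrite (hom_subst_head (model_hom hM)) // subst_headE tnth0.
    by congr (h f _); apply: val_inj.
  rewrite -hE //.
  apply: (@model_rule n [set proj_op ord0; subst_head f r]).
  - by move=> _ [->|->]; [exact: clone_proj | exact: clone_subst_head].
  - exact: clone_subst_head.
  - move=> x prem; have := prem _ (or_intror erefl); rewrite !subst_headE rs //.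
    exact: (prem _ (or_introl erefl)).
  - move=> _ [->|->]; last by rewrite hE.
    by rewrite (hom_proj (model_hom hM)) /proj_op tnth0.
move=> Cp Cq pq Ga n _ c /(model_surj hM)[f Cf <-]; split; apply: imp => //.
by move=> x Gx; rewrite pq.
Qed.

Lemma leibniz_mem (a b : A') : leibniz D' G' a b -> G' a <-> G' b.
Proof.
by move=> /(_ 0 (proj_op ord0) [tuple] (clone_proj (model_clone hM) _)).
Qed.

End Model.

End CloneTheory.

(** * Unary operations of De Morgan clones *)

Definition DM4_swap (x : DM4) : DM4 :=
  match x with DMn => DMb | DMb => DMn | _ => x end.

Definition unop (f : DM4 -> DM4) : op DM4 0 := fun x => f (tnth x ord0).

Lemma unopE (t : op DM4 0) : t = unop (fun y => t [tuple y]).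
Proof. by apply: funext => x; rewrite /unop tuple1E. Qed.

Section DeMorganClone.
Variable C : opset DM4.
Hypotheses (hC : is_clone C) (hDMA : sub_opset DMA C).

Lemma clone_DMA_gen n (f : op DM4 n) : DMA_gen f -> C f.
Proof. by move=> gf; apply: hDMA => D _; apply. Qed.

Lemma clone_id : C (unop id).
Proof. exact: (clone_proj hC). Qed.

Lemma clone_neg f : C (unop f) -> C (unop (DM4_neg \o f)).
Proof.
move=> Cf; have := clone_comp hC (clone_DMA_gen DMA_neg) (fun=> Cf).
by congr (C _); apply: funext => x; rewrite /comp_op /neg_op tnth_mktuple.
Qed.

Lemma clone_binop (o : op DM4 1) (f g : DM4 -> DM4) :
  C o -> C (unop f) -> C (unop g) ->
  C (unop (fun y => o [tuple f y; g y])).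
Proof.
move=> Co Cf Cg.
have := clone_comp (n:=0)
  (g := fun i : 'I_2 => if i == ord0 then unop f else unop g) hC Co.
have -> : comp_op o (fun i : 'I_2 => if i == ord0 then unop f else unop g) =
          unop (fun y => o [tuple f y; g y]).
  apply: funext => x; rewrite /comp_op; congr (o _).
  by apply: eq_from_tnth => i; rewrite tnth_mktuple; case: i => [[|[]]].
by apply=> i; case: ifP.
Qed.

Lemma clone_meet f g : C (unop f) -> C (unop g) ->
  C (unop (fun y => DM4_meet (f y) (g y))).
Proof. exact: clone_binop (clone_DMA_gen DMA_meet). Qed.

Lemma clone_join f g : C (unop f) -> C (unop g) ->
  C (unop (fun y => DM4_join (f y) (g y))).
Proof. exact: clone_binop (clone_DMA_gen DMA_join). Qed.

(* [x \/ -x \/ f(x) \/ -f(x)] keeps [n] (resp. [b]) exactly when [f] fixes it,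
   and takes the value [t] otherwise. *)
Lemma clone_fixes_one f : C (unop f) -> (f DMn == DMn) != (f DMb == DMb) ->
  C t_n_to_n \/ C t_b_to_b.
Proof.
move=> Cf.
have := clone_join (clone_join clone_id (clone_neg clone_id))
                   (clone_join Cf (clone_neg Cf)).
set g := (X in unop X) => Cg fixes_one.
move: fixes_one; case: (f DMn =P DMn) => fn; case: (f DMb =P DMb) => fb // _.
- left; suff <- : unop g = t_n_to_n by [].
  apply: funext => x; rewrite /unop /t_n_to_n /g /=.
  case: (tnth x ord0); rewrite ?fn //=; first [by case: (f _) | idtac].
  by case: (f DMb) fb.
- right; suff <- : unop g = t_b_to_b by [].
  apply: funext => x; rewrite /unop /t_b_to_b /g /=.
  case: (tnth x ord0); rewrite ?fb //=; first [by case: (f _) | idtac].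
  by case: (f DMn) fn.
Qed.

Lemma clone_not_swap f : C (unop f) -> f DMb != DM4_swap (f DMn) ->
  C t_n_to_n \/ C t_b_to_b.
Proof.
move=> Cf nswap.
(* One of [f(x)], [x /\ f(x)], [x /\ -f(x)] fixes exactly one of [n] and [b]; the last is needed
   when [f] sends one of them to [f] and the other to its swap. *)
have C1 := clone_fixes_one Cf.
have C2 := clone_fixes_one (clone_meet clone_id Cf).
have C3 := clone_fixes_one (clone_meet clone_id (clone_neg Cf)).
move: nswap C1 C2 C3 => /=.
by case: (f DMn); case: (f DMb) => // _ C1 C2 C3;
   solve [exact: C1 | exact: C2 | exact: C3].
Qed.

(** The tests [x] and [-x] suffice: which of the two are designated determines [x]. *)
Lemma leibniz_designated (x y : DM4) : leibniz C designated x y -> x = y.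
Proof.
move=> xy.
have := xy 0 _ [tuple] clone_id; have := xy 0 _ [tuple] (clone_neg clone_id).
rewrite /unop /= !tnth0.
have desE z : designated z <-> z \in [:: DMt; DMb].
  by rewrite !inE; split=> [[]->|/orP[]/eqP->] //; [left|right].
rewrite !desE /=.
by case: x xy => _; case: y => // -[P Q] [R S];
   first [by have := P isT | by have := Q isT | by have := R isT | by have := S isT].
Qed.

(** * The two directions of the equivalence *)

Lemma truth_equational_clone : truth_equational C designated ->
  C t_n_to_n \/ C t_b_to_b.
Proof.
case=> E CE truthE.
(* The matrix is a model of its own logic, via the identity. *)
have hM : is_model C designated C designated (fun=> id).
  split=> //.
  - by move=> n f Cf; exists f.
  - by move=> n Gamma Theta _ _; rewrite /= !image_id.
have [dn _] := truthE _ _ _ _ hM DMb.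
have [_ nd] := truthE _ _ _ _ hM DMn.
apply: contrapT => nC.
have swap p : C p -> p [tuple DMb] = DM4_swap (p [tuple DMn]).
  rewrite {1}(unopE p) => Cp.
  by apply: contrapT => /eqP /(clone_not_swap Cp).
suff : designated DMn by case.
apply: nd => t u Etu; have [Ct Cu] := CE _ Etu.
have /leibniz_designated := dn (or_intror erefl) t u Etu.
(* The equations hold at the designated [b]. As the swap is injective, they then hold at [n] too,
   which would make [n] designated. *)
rewrite (swap t) // (swap u) // => tu.
suff -> : t [tuple DMn] = u [tuple DMn] by move=> n f c.
by move: tu; case: (t _); case: (u _).
Qed.

Lemma truth_equational_t_b : C t_b_to_b -> truth_equational C designated.
Proof.
move=> Ctb; exists [set (t_b_to_b, unop id)].
  by move=> _ ->; split=> //; exact: clone_id.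
move=> A' D' G' h hM a; split.
- move=> Ga t u [-> ->]; apply: (model_leibniz hC hM) => //.
    exact: clone_id.
  by move=> x; rewrite /unop /t_b_to_b; case: (tnth x ord0) => [||| ] [].
- move=> /(_ _ _ erefl) /(leibniz_mem hM)[+ _].
  rewrite (hom_proj (model_hom hM) ord0 : h 0 (unop id) = _); apply.
  apply: (model_rule hM (Gamma := set0)) => //.
  by move=> x _; rewrite /t_b_to_b; case: (tnth x ord0); [left|left|left|right].
Qed.

Lemma truth_equational_t_n : C t_n_to_n -> truth_equational C designated.
Proof.
move=> Ctn.
have Cem := clone_join clone_id (clone_neg clone_id).
set em := (X in C X) in Cem.
have Ctt := clone_DMA_gen DMA_t.
exists [set (t_n_to_n, const_op DMt); (em, unop id)].
  by move=> _ [->|->]; split=> //; exact: clone_id.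
move=> A' D' G' h hM a; split.
- move=> Ga t u [|] [-> ->]; apply: (model_leibniz hC hM) => //.
  + by move=> x; rewrite /t_n_to_n; case: (tnth x ord0) => [||| ] [].
  + exact: clone_id.
  + by move=> x; rewrite /em /unop; case: (tnth x ord0) => [||| ] [].
- move=> eqs.
  have /(leibniz_mem hM)[_ Gtn] := eqs _ _ (or_introl erefl).
  have /(leibniz_mem hM)[+ _] := eqs _ _ (or_intror erefl).
  (* The second equation reduces membership of [a] to that of the image of [x \/ -x] at [a]; the
     first supplies the premise [t_n(x)] of the rule used next. *)
  rewrite (hom_proj (model_hom hM) ord0 : h 0 (unop id) = _); apply.
  apply: (model_rule hM (Gamma := [set t_n_to_n])) => //.
  + by move=> _ ->.
  + move=> x /(_ _ erefl); rewrite /em /unop /t_n_to_n.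
    by case: (tnth x ord0) => [||| ] [] // _; [left|left|right].
  + move=> _ ->; apply: Gtn; apply: (model_rule hM (Gamma := set0)) => //.
    by move=> x _; left.
Qed.

End DeMorganClone.

Theorem mainTheorem16 (C : opset DM4) (hC : is_clone C)
  (hDMA : sub_opset DMA C) :
  truth_equational C designated <-> C 0 t_n_to_n \/ C 0 t_b_to_b.
Proof.
split; first exact: truth_equational_clone.
by case; [exact: truth_equational_t_n | exact: truth_equational_t_b].
Qed.
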